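(* For $k\geq 0$ let $\mu_k=\lim_{n\to\infty}\frac{p_{n;\leq n-k}}{(n+1)^{n-1}}$. Then $\mu_0=1$ and for every $k\geq 1$ $$\mu_{k}=1-\sum_{i=1}^k\frac{(k-i+1)(k+1)^{i-1}}{i!}e^{-i}\mu_{k-i},$$ equivalently $\mu_{k}=\sum_{i=0}^{k}\frac{(-1)^{i}(k+1-i)^{i}}{i!}e^{-i}$ for all $k\ge 0$. Moreover the generating function $\mu(x)=\sum_{k\geq 0}\mu_kx^k$ equals $\left(e^{x/e}-x\right)^{-1}$.
   Context: There are $n$ parking spaces in a line numbered $1,\dots,n$; $n$ cars arrive in order, car $j$ has preference $a_j\in[n]$ and parks in the first unoccupied space numbered $\geq a_j$, if any; $(a_1,\dots,a_n)$ is a parking function if all cars park. $p_{n;\leq s}$ is the number of parking functions of length $n$ with all $a_j\leq s$. *)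

(* Defs.v *)
From HB Require Import structures.
From mathcomp Require Import all_boot all_order all_algebra.
From mathcomp Require Import all_classical all_reals all_analysis.

Set Implicit Arguments.
Unset Strict Implicit.
Unset Printing Implicit Defensive.

Import Order.TTheory GRing.Theory Num.Theory.
Import numFieldNormedType.Exports.

Local Open Scope classical_set_scope.
Local Open Scope ring_scope.

(* The space (or preference) numbered j in 1, ..., n is the ordinal of value  *)
(* j - 1 in 'I_n.  [enum 'I_n] is increasing, so [ohead] selects the first    *)
(* unoccupied space from [a] on, if there is one.                             *)
Definition first_free (n : nat) (occ : {set 'I_n}) (a : 'I_n) : option 'I_n :=
  ohead [seq i : 'I_n <- enum 'I_n | (a <= i)%N && (i \notin occ)].

Fixpoint park (n : nat) (occ : {set 'I_n}) (prefs : seq 'I_n) :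
    seq (option 'I_n) :=
  if prefs is a :: prefs' then
    let o := first_free occ a in
    o :: park (if o is Some i then (i |: occ)%SET else occ) prefs'
  else [::].

Definition parking_function (n : nat) (a : n.-tuple 'I_n) : bool :=
  all isSome (park finset.set0 a).

(* The 1-based bound a_j <= s reads i.+1 <= s on ordinals. *)
Definition num_pf_le (n s : nat) : nat :=
  #|[pred a : n.-tuple 'I_n |
      parking_function a && all (fun i : 'I_n => (i.+1 <= s)%N) a]|.

Definition pf_ratio (R : realType) (k n : nat) : R :=
  (num_pf_le n (n - k))%:R / ((n.+1 ^ n.-1)%N)%:R.

Definition pf_mu (R : realType) (k : nat) : R :=
  limn (pf_ratio R k).

(* A formal power series is represented by its sequence of coefficients. *)
Definition fps_mul (R : realType) (a b : nat -> R) (k : nat) : R :=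
  \sum_(i < k.+1) a i * b (k - i)%N.

Definition fps_one (R : realType) (k : nat) : R := (k == 0%N)%:R.

(* coefficients of e^{x/e} - x *)
Definition fps_exp_sub_X (R : realType) (k : nat) : R :=
  (expR 1)^-1 ^+ k / k`!%:R - (k == 1%N)%:R.

Definition cv_radius (R : realType) (a : nat -> R) : \bar R :=
  ereal_sup [set `|y|%:E | y in [set y : R | cvgn (pseries a y)]].

(* Main.v *)
(** A sequence with letters in {1, ..., n} is a parking function iff, for every
    [b], at most n - b + 1 of its letters are >= b (Hall's condition).  Hence,
    writing P(m, s) for the number of words of length m over {1, ..., s} in
    which at least j letters are <= j for every j <= s, we have
    p_{n; <= s} = P(n, s), and sorting the words by the positions of the letter
    s gives P(m, s + 1) = sum_i C(m, i) P(m - i, s) for s < m.  Iterating from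
    (n, n) down to s = 0, Abel-type coefficients appear and P(n, n) =
    (n + 1)^(n - 1).  Dividing the recursion by (n + 1)^(n - 1) and letting n
    tend to infinity yields mu_k = sum_{i <= k+1} e^(-i) / i! mu_(k+1-i), which
    is the coefficient form of mu(x) (e^(x/e) - x) = 1; the Abel recurrence and
    the closed formula are both consequences of it.  Analytically, the
    identity follows from the Cauchy product of absolutely convergent series. *)
Require Import Defs.
From HB Require Import structures.
From mathcomp Require Import all_boot all_order all_algebra.
From mathcomp Require Import all_classical all_reals all_analysis.
From mathcomp Require Import zify ring.

Import Order.TTheory GRing.Theory Num.Theory.
Import numFieldNormedType.Exports.

Local Open Scope classical_set_scope.
Local Open Scope ring_scope.

(** * Parking and words *)

Section ParkingCriterion.
Local Open Scope nat_scope.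
Variable n : nat.
Implicit Types (occ : {set 'I_n}) (a : 'I_n) (s : seq 'I_n) (b : nat).

Definition occ_from occ b := \sum_(i < n | b <= i) (i \in occ).
Definition count_from s b := count (fun i : 'I_n => b <= i) s.

Lemma first_freeP occ a :
  match first_free occ a with
  | Some i => [/\ a <= i, i \notin occ &
                  forall j : 'I_n, a <= j -> j < i -> j \in occ]
  | None => forall j : 'I_n, a <= j -> j \in occ
  end.
Proof.
rewrite /first_free.
set p := fun i : 'I_n => (a <= i) && (i \notin occ).
have srt : sorted ltn (map val [seq i <- enum 'I_n | p i]).
  apply: (@subseq_sorted _ _ ltn_trans _ (map val (enum 'I_n))).
    exact/map_subseq/filter_subseq.
  by rewrite val_enum_ord iota_ltn_sorted.
have mem j : (j \in [seq i <- enum 'I_n | p i]) = p j.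
  by rewrite mem_filter mem_enum andbT.
case: [seq i <- enum 'I_n | p i] srt mem => [|i l] /= srt mem.
  move=> j aj; apply/negPn/negP => nj; have := mem j.
  by rewrite in_nil /p aj nj.
have := mem i; rewrite inE eqxx /= => /esym/andP[ai ni]; split=> //.
move=> j aj ji; apply/negPn/negP => nj; have := mem j.
rewrite /p aj nj inE => /orP[/eqP ej|jl]; first by rewrite ej ltnn in ji.
have /allP/(_ (val j)) := order_path_min ltn_trans srt.
rewrite map_f // => /(_ isT) ij.
by have := ltn_trans ij ji; rewrite ltnn.
Qed.

Lemma occ_from_step occ (i : 'I_n) :
  occ_from occ i = (i \in occ) + occ_from occ i.+1.
Proof.
rewrite /occ_from (bigD1 i) //=; congr (_ + _).
by apply: eq_bigl => j; rewrite ltn_neqAle eq_sym andbC.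
Qed.

Lemma occ_from_filled occ a b : a <= b <= n ->
  (forall j : 'I_n, a <= j -> j < b -> j \in occ) ->
  occ_from occ a = b - a + occ_from occ b.
Proof.
move=> /andP[]; elim: b => [|b IHb] ab bn filled.
  by have -> : nat_of_ord a = 0 by lia.
move: ab; rewrite leq_eqVlt => /predU1P[->|ab]; first by rewrite subnn.
rewrite IHb //; [|lia|by move=> j aj jb; apply: filled => //; lia].
rewrite (occ_from_step occ (Ordinal bn)) /= filled //=; lia.
Qed.

Lemma occ_fromU1 occ (i : 'I_n) b : i \notin occ ->
  occ_from (i |: occ)%SET b = (b <= i) + occ_from occ b.
Proof.
move=> ni; rewrite /occ_from.
rewrite (eq_bigr (fun j : 'I_n => (j == i) + (j \in occ))); last first.
  by move=> j _; rewrite !inE; case: eqP => // ->; rewrite (negPf ni).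
rewrite big_split /=; congr (_ + _).
case: (leqP b i) => bi.
  rewrite (bigD1 i) //= eqxx big1 // => j /andP[_ ji].
  by rewrite (negPf ji).
by rewrite big1 // => j bj; case: eqP => // ji; rewrite ji leqNgt bi in bj.
Qed.

(* Hall's condition for the cars still to park: those preferring a space from
   [b] on must fit into the free spaces from [b] on. *)
Lemma all_parkP occ s :
  reflect (forall b, b <= n -> occ_from occ b + count_from s b <= n - b)
          (all isSome (park occ s)).
Proof.
have occ_n o : occ_from o n = 0.
  by rewrite /occ_from big1 // => j; rewrite leqNgt ltn_ord.
have occ_le o b : b <= n -> occ_from o b <= n - b.
  move=> bn; rewrite -(subKn bn); move: (n - b) (leq_subr b n) => d.
  elim: d => [|d IHd] dn; first by rewrite subn0 occ_n.
  have lt : n - d.+1 < n by lia.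
  rewrite (occ_from_step o (Ordinal lt)) /= (_ : (n - d.+1).+1 = n - d);
    last by lia.
  have := IHd (ltnW dn); case: (_ \in o); lia.
apply: (iffP idP); elim: s occ => [|a s IHs] occ /=.
- by move=> _ b bn; rewrite addn0 occ_le.
- have := first_freeP occ a; case: first_free => //= i [ai ni _].
  move=> /IHs H b bn; have := H b bn; rewrite occ_fromU1 //.
  case: (leqP b a) => ba; case: (leqP b i) => bi /=; lia.
- by [].
- have an : a <= n by exact: ltnW.
  have := first_freeP occ a; case: first_free => [i [ai ni filled]|filled] H.
    apply: IHs => b bn; have := H b bn; rewrite occ_fromU1 //.
    case: (leqP b i) => bi; case: (leqP b a) => ba /=; try lia.
    (* Here [a < b <= i]. All spaces from [a] to [b - 1] are occupied, so the condition at [a],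
       which counts the present car, yields the one at [b]. *)
    have := H a an; rewrite leqnn /=.
    rewrite (occ_from_filled occ a b) ?(ltnW ba) //; last first.
      by move=> j aj jb; apply: filled => //; lia.
    have := @sub_count _ (fun i : 'I_n => b <= i) (fun i : 'I_n => a <= i).
    move=> /(_ (fun x bx => leq_trans (ltnW ba) bx) s);
      rewrite -!/(count_from _ _); lia.
  (* With no free space from [a] on, the [n - a] occupied spaces and the present car violate the
     condition at [a]. *)
  have := H a an; rewrite leqnn /=.
  rewrite (occ_from_filled occ a n) ?an ?leqnn ?occ_n //.
    by rewrite addn0 add1n addnS ltnNge leq_addr.
  by move=> j aj _; exact: filled.
Qed.

(** Hall's condition for an empty line of spaces, passed to the complementary letters. *)
Lemma parking_functionP (t : n.-tuple 'I_n) :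
  reflect (forall b, b <= n -> b <= count (fun i : 'I_n => i < b) t)
          (parking_function t).
Proof.
have occ0 b : occ_from finset.set0 b = 0.
  by rewrite /occ_from big1 // => j _; rewrite inE.
have cE b : count_from t b = n - count (fun i : 'I_n => i < b) t.
  rewrite -[X in X - _](size_tuple t) -(count_predC (fun i : 'I_n => i < b)).
  by rewrite addKn; apply: eq_count => j /=; rewrite -leqNgt.
apply: (iffP (all_parkP _ _)) => H b bn; have := H b bn; rewrite occ0 cE.
  have := count_size (fun i : 'I_n => i < b) t; rewrite size_tuple; lia.
lia.
Qed.

End ParkingCriterion.

(** * Counting words over an alphabet of varying size *)

Section Words.
Local Open Scope nat_scope.

(** Words are plain sequences of naturals, so that [s] and [m] can vary in a recursion without a
    change of type. *)
Fixpoint sum_words (s m : nat) (g : seq nat -> nat) : nat :=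
  if m is m'.+1 then \sum_(a < s) sum_words s m' (fun w => g
    (nat_of_ord a :: w))
  else g [::].

Lemma eq_sum_words s m g h :
  (forall w, size w = m -> all (fun a => a < s) w -> g w = h w) ->
  sum_words s m g = sum_words s m h.
Proof.
elim: m g h => [|m IHm] g h gh /=; first exact: gh.
apply: eq_bigr => a _; apply: IHm => w sw aw.
by apply: gh; rewrite /= ?sw // ltn_ord.
Qed.

Lemma sum_words0 s m : sum_words s m (fun=> 0) = 0.
Proof. by elim: m => //= m IHm; rewrite big1. Qed.

Lemma sum_words_tuple n m (g : seq nat -> nat) :
  \sum_(t : m.-tuple 'I_n) g (map val t) = sum_words n m g.
Proof.
elim: m g => [|m IHm] g /=.
  rewrite (big_pred1 [tuple]) // => t /=.
  by apply/esym/eqP; exact: tuple0.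
transitivity (\sum_(a < n) \sum_(t : m.-tuple 'I_n) g (val a :: map val t)).
  rewrite pair_big /=.
  rewrite (reindex (fun p : 'I_n * m.-tuple 'I_n => [tuple of p.1 :: p.2])) //=.
  exists (fun t => (thead t, [tuple of behead t])) => [[a t] _|t _].
    by congr (_, _); apply: val_inj.
  by rewrite [RHS]tuple_eta; apply: val_inj.
by apply: eq_bigr => a _; rewrite -IHm.
Qed.

Lemma sum_words_all n s m g : s <= n ->
  sum_words n m (fun w => all (fun a => a < s) w * g w) = sum_words s m g.
Proof.
move=> sn; elim: m g => [|m IHm] g /=; first by rewrite mul1n.
rewrite (big_ord_widen n (fun a => sum_words s m (fun w => g (a :: w))) sn).
rewrite [RHS]big_mkcond; apply: eq_bigr => a _; case: ifP => lta.
  by rewrite -IHm.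
by rewrite -[RHS](sum_words0 n m); apply: eq_sum_words.
Qed.

(* Pascal's rule: the positions of the letter [s] are deleted. *)
Lemma sum_words_filter s m g :
  sum_words s.+1 m (fun w => g [seq a <- w | a < s]) =
  \sum_(i < m.+1) 'C(m, i) * sum_words s (m - i) g.
Proof.
elim: m g => [|m IHm] g; first by rewrite big_ord1 mul1n.
rewrite [RHS]big_ord_recl bin0 subn0 mul1n.
under [X in _ = _ + X]eq_bigr => i _ do
  rewrite lift0 subSS binS mulnDl.
rewrite big_split /= addnA.
(* A leading letter [s] is deleted and gives the ['C(m, i)] half of Pascal's rule; a smaller leading
   letter gives the ['C(m, i.+1)] half. *)
rewrite big_ord_recr /= ltnn IHm; congr (_ + _).
have /= -> := @big_ord_recr _ 0 addn m
  (fun i => 'C(m, i.+1) * sum_words s (m - i) g).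
rewrite bin_small // mul0n addn0.
transitivity (\sum_(a < s) \sum_(i < m.+1)
    'C(m, i) * sum_words s (m - i) (fun w => g (nat_of_ord a :: w))).
  by apply: eq_bigr => a _; rewrite -IHm; apply: eq_sum_words => w _ _;
    rewrite ltn_ord.
rewrite exchange_big big_ord_recl bin0 subn0.
congr (_ + _); first by apply: eq_bigr => a _; rewrite mul1n.
apply: eq_bigr => i _; rewrite lift0 -big_distrr /=; congr (_ * _).
by have -> : m - i = (m - i.+1).+1 by have := ltn_ord i; lia.
Qed.

Definition parks s (w : seq nat) : bool :=
  all (fun j => j <= count (fun a => a < j) w) (iota 0 s.+1).

(** This is P(m, s). Length and alphabet are independent because deleting the letter [s] shortens
    words by varying amounts. *)
Definition num_pf m s := sum_words s m (fun w => parks s w).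

(** The conditions at [b > s] are automatic, since all [n] letters lie below [s]; those at [b <= s]
    form [parks]. *)
Lemma num_pf_leE n s : s <= n -> num_pf_le n s = num_pf n s.
Proof.
move=> sn; rewrite /num_pf_le -sum1_card big_mkcond /=.
rewrite /num_pf -(sum_words_all n) // -sum_words_tuple.
apply: eq_bigr => t _; rewrite inE /= mulnb andbC all_map.
case tlt: (all _ t) => //=.
congr nat_of_bool; apply/parking_functionP/allP => H b.
  rewrite mem_iota add0n count_map => /andP[_ bs]; apply: H; lia.
case: (leqP b s) => bs bn.
  by have := H b; rewrite mem_iota add0n ltnS bs count_map; exact.
suff /eqP -> : count (fun i : 'I_n => i < b) t == size t by rewrite size_tuple.
rewrite -all_count; apply: sub_all tlt => i /= iS.
exact: leq_trans iS (ltnW bs).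
Qed.

Lemma num_pf0 m : num_pf m 0 = (m == 0).
Proof. by case: m => [|m] //; rewrite /num_pf /= big_ord0. Qed.

Lemma num_pf_small m s : m < s -> num_pf m s = 0.
Proof.
move=> ms; rewrite /num_pf -[RHS](sum_words0 s m);
  apply: eq_sum_words => w sw _.
case: (boolP (parks s w)) => // /allP/(_ s);
  rewrite mem_iota add0n ltnSn => /(_ isT).
by have := count_size (fun a => a < s) w; rewrite sw => ? ?; lia.
Qed.

(** The conditions at [j <= s] do not see the letter [s], hence survive its deletion; the one at
    [s.+1] counts all letters and is exactly [s < m]. *)
Lemma num_pfS m s : s < m ->
  num_pf m s.+1 = \sum_(i < m.+1) 'C(m, i) * num_pf (m - i) s.
Proof.
move=> sm; rewrite /num_pf -(sum_words_filter s m (fun w => parks s w)).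
apply: eq_sum_words => w sw ws; congr nat_of_bool.
rewrite /parks -[s.+2]addn1 iotaD all_cat all_seq1 add0n.
have -> : count (fun a => a < s.+1) w = m.
  by rewrite -sw; apply/eqP; rewrite -all_count.
rewrite sm andbT; apply: eq_in_all => j; rewrite mem_iota add0n ltnS /= => js.
rewrite count_filter; congr (_ <= _); apply: eq_count => a /=.
by case: (ltnP a j) => //= aj; rewrite (leq_trans aj js).
Qed.

End Words.

(** * Abel coefficients *)

Section ExpCoeff.
Variable R : realType.
Implicit Types (x y : R) (F : nat -> nat -> R).

Lemma sum_triangle n F :
  \sum_(i < n) \sum_(j < (n - i)%N) F i j =
  \sum_(t < n) \sum_(i < t.+1) F i (t - i)%N.
Proof.
elim: n => [|n IHn]; first by rewrite !big_ord0.
rewrite [RHS]big_ord_recr /= -IHn big_ord_recr /= subSn // subnn big_ord1.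
rewrite [X in _ = _ + X]big_ord_recr /= subnn addrA; congr (_ + _).
rewrite -big_split /=; apply: eq_bigr => i _.
by rewrite subSn 1?ltnW // big_ord_recr.
Qed.

Lemma fact_neq0 m : m`!%:R != 0 :> R.
Proof. by rewrite pnatr_eq0 -lt0n fact_gt0. Qed.

Lemma exp_coeffD x y n :
  \sum_(i < n.+1) exp_coeff x i * exp_coeff y (n - i)%N = exp_coeff (x + y) n.
Proof.
rewrite /exp_coeff /= addrC exprDn mulr_suml; apply: eq_bigr => i _.
have le_in : (i <= n)%N by rewrite -ltnS.
rewrite -mulr_natr -(bin_fact le_in) !natrM.
have h1 : i`!%:R != 0 :> R by exact: fact_neq0.
have h2 : (n - i)`!%:R != 0 :> R by exact: fact_neq0.
have h3 : 'C(n, i)%:R != 0 :> R by rewrite pnatr_eq0 -lt0n bin_gt0.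
by field; rewrite h1 h2 h3.
Qed.

(* This is (k + 1 - i) (k + 1)^(i - 1) / i!, written as a difference so that
   convolution with the exponential series is a shift of [k]. *)
Definition abel_coeff k i : R :=
  exp_coeff k.+1%:R i - (if i is j.+1 then exp_coeff k.+1%:R j else 0).

Lemma abel_coeffE k i : (0 < i <= k)%N ->
  abel_coeff k i = (k - i + 1)%N%:R * (k + 1)%N%:R ^+ (i - 1) / i`!%:R.
Proof.
case: i => // i /= ik; rewrite /abel_coeff /exp_coeff /=.
have -> : (k - i.+1 + 1 = k.+1 - i.+1)%N by lia.
rewrite natrB; last by lia.
rewrite subn1 addn1 factS natrM exprS /=.
have h1 : i`!%:R != 0 :> R by exact: fact_neq0.
have h2 : i.+1%:R != 0 :> R by rewrite pnatr_eq0.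
by field; rewrite h1 ?nat1r ?natr1 h2.
Qed.

(** The generating function of [abel_coeff k] is (1 - x) e^((k+1)x), and multiplication by e^x
    raises [k] by one. *)
Lemma abel_coeff_conv k t :
  \sum_(i < t.+1) abel_coeff k i * exp_coeff 1 (t - i)%N = abel_coeff k.+1 t.
Proof.
rewrite /abel_coeff -[k.+2]addn1 natrD -exp_coeffD.
under eq_bigr => i _ do rewrite mulrBl.
rewrite sumrB; congr (_ - _); rewrite big_ord_recl mul0r add0r.
case: t => [|t]; first by rewrite big_ord0.
by rewrite -exp_coeffD; apply: eq_bigr => i _; rewrite lift0 subSS.
Qed.

Lemma abel_coeff_last k : abel_coeff k k.+1 = 0.
Proof.
rewrite /abel_coeff /exp_coeff /= factS natrM exprS.
have h1 : k`!%:R != 0 :> R by exact: fact_neq0.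
have h2 : k.+1%:R != 0 :> R by rewrite pnatr_eq0.
by apply/eqP; rewrite subr_eq0; apply/eqP; field; rewrite h1 ?nat1r ?natr1 h2.
Qed.

(** Each use of the recursion convolves the current coefficients with the exponential series. The
    array [U] is abstract because the lemma serves both the finite counts and their limits. *)
Lemma abel_coeff_sum K (U : nat -> nat -> R) :
  (forall k i, (i <= k < K)%N ->
     U k i = \sum_(l < (k.+2 - i)%N) exp_coeff 1 l * U k.+1 (i + l)%N) ->
  forall k, (k <= K)%N -> U 0 0 = \sum_(i < k.+1) abel_coeff k i * U k i.
Proof.
move=> HU; elim=> [_|k IHk kK].
  by rewrite big_ord1 /abel_coeff /exp_coeff /= subr0 expr0 fact0 divr1 mul1r.
rewrite (IHk (ltnW kK)).
transitivity (\sum_(i < k.+2) \sum_(l < (k.+2 - i)%N)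
    abel_coeff k i * exp_coeff 1 l * U k.+1 (i + l)%N).
  (* The recursion says nothing at [i = k.+1], but [abel_coeff_last] kills that term, so the sum
     extends to a full triangle. *)
  rewrite [RHS]big_ord_recr /= [X in _ = _ + X]big1; last first.
    by move=> l _; rewrite abel_coeff_last !mul0r.
  rewrite addr0; apply: eq_bigr => i _; rewrite HU; last first.
    by rewrite -ltnS ltn_ord kK.
  by rewrite mulr_sumr; apply: eq_bigr => l _; rewrite mulrA.
rewrite (sum_triangle _ (fun i l => abel_coeff k i * exp_coeff 1 l * U k.+1
  (i + l)%N)).
apply: eq_bigr => t _; rewrite -abel_coeff_conv mulr_suml.
by apply: eq_bigr => i _; rewrite subnKC // -ltnS.
Qed.

End ExpCoeff.

(** * Exponentially normalized counts and the formula (n + 1)^(n - 1) *)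

Section Counting.
Variable R : realType.

(** Division by [m!] turns the binomial coefficients of [num_pfS] into coefficients of e^x. *)
Definition pf_egf m s : R := (num_pf m s)%:R / m`!%:R.

Lemma pf_egfS m s : (s < m)%N ->
  pf_egf m s.+1 = \sum_(l < (m - s).+1) exp_coeff 1 l * pf_egf (m - l) s.
Proof.
move=> sm; rewrite /pf_egf num_pfS // natr_sum mulr_suml.
have le : ((m - s).+1 <= m.+1)%N by rewrite ltnS leq_subr.
rewrite (big_ord_widen m.+1
  (fun l => exp_coeff 1 l * ((num_pf (m - l) s)%:R / (m - l)`!%:R)) le).
(* For [l > m - s] fewer than [s] letters remain, and the count vanishes. *)
rewrite [RHS]big_mkcond /=; apply: eq_bigr => l _; case: ifP => lms; last first.
  by rewrite num_pf_small ?muln0 ?mul0r //; move: (ltn_ord l) lms; lia.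
have lm : (l <= m)%N by rewrite -ltnS.
rewrite /exp_coeff /= expr1n -(bin_fact lm) !natrM.
have h3 : 'C(m, l)%:R != 0 :> R by rewrite pnatr_eq0 -lt0n bin_gt0.
by field; rewrite !fact_neq0 h3.
Qed.

(** The iteration is run down to the empty alphabet, [k = n], where only the empty word, [i = n],
    contributes; its coefficient is [abel_coeff n n]. *)
Lemma num_pf_diag n : (num_pf n n)%:R = (n.+1 ^ n.-1)%N%:R :> R.
Proof.
have H : pf_egf n n = abel_coeff R n n.
  rewrite -{1 2}(subn0 n).
  rewrite (@abel_coeff_sum R n (fun k i => pf_egf (n - i) (n - k)) _ n) //.
    rewrite big_ord_recr /= subnn /pf_egf num_pf0 eqxx fact0 divr1 mulr1.
    rewrite big1 ?add0r // => i _.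
    by rewrite num_pf0 subn_eq0 leqNgt ltn_ord mul0r mulr0.
  move=> k i /andP[ik kn]; rewrite -(subnSK kn) pf_egfS; last by lia.
  have -> : ((n - i - (n - k.+1)).+1 = k.+2 - i)%N by lia.
  by apply: eq_bigr => l _; rewrite subnDA.
move: H; rewrite /pf_egf => /(canRL (mulfVK (fact_neq0 R n))) H.
rewrite H; case: n {H} => [|n].
  by rewrite /abel_coeff /exp_coeff /= subr0 expr0 fact0 divr1 mulr1.
rewrite abel_coeffE ?leqnn // subnn subn1 !addn1 natrX mul1r.
by rewrite divfK ?fact_neq0.
Qed.

End Counting.

(** * Limits *)

Section Limits.
Variable R : realType.

(** By [num_pf_diag] this is [pf_egf n n]. *)
Definition pf_weight n : R := (n.+1 ^ n.-1)%N%:R / n`!%:R.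

Lemma pf_weight_neq0 n : pf_weight n != 0.
Proof.
by rewrite mulf_neq0 ?invr_neq0 ?fact_neq0 // pnatr_eq0 -lt0n expn_gt0.
Qed.

Lemma pf_ratioE k n : pf_ratio R k n = pf_egf R n (n - k) / pf_weight n.
Proof.
rewrite /pf_ratio num_pf_leE ?leq_subr // /pf_egf /pf_weight.
by rewrite invf_div mulrA mulfVK ?fact_neq0.
Qed.

Lemma pf_ratio0 n : pf_ratio R 0 n = 1.
Proof.
by rewrite /pf_ratio subn0 num_pf_leE // num_pf_diag divff // pnatr_eq0 -lt0n
  expn_gt0.
Qed.

(** Deleting [i] letters leaves length [n - i] over [n - k.+1] letters, a gap of [k.+1 - i]; the
    weights compensate for the changed denominators. *)
Lemma pf_ratioS k n : (k < n)%N ->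
  pf_ratio R k n = \sum_(i < k.+2) exp_coeff 1 i *
    (pf_weight (n - i) / pf_weight n) * pf_ratio R (k.+1 - i) (n - i).
Proof.
move=> kn; rewrite pf_ratioE -(subnSK kn) pf_egfS; last by lia.
have -> : ((n - (n - k.+1)).+1 = k.+2)%N by lia.
rewrite mulr_suml; apply: eq_bigr => i _; rewrite pf_ratioE.
have -> : (n - i - (k.+1 - i) = n - k.+1)%N by have := ltn_ord i; lia.
have h1 := pf_weight_neq0 n; have h2 := pf_weight_neq0 (n - i).
by field; rewrite h1 h2.
Qed.

Lemma pf_weight_ratio n :
  pf_weight n / pf_weight n.+1 = (n.+1%:R / n.+2%:R) ^+ n.
Proof.
case: n => [|n]; first by rewrite /pf_weight !divr1.
rewrite /pf_weight [(n.+2)`!]factS natrM !natrX /= expr_div_n.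
move: (fact_neq0 R n.+1).
have : n.+2%:R != 0 :> R by rewrite pnatr_eq0.
have : n.+3%:R ^+ n.+1 != 0 :> R by rewrite expf_neq0 // pnatr_eq0.
rewrite [n.+2%:R ^+ n.+1]exprSr.
move: (n.+1)`!%:R n.+2%:R (n.+3%:R ^+ n.+1) => f a c hc ha hf.
by field; rewrite hf hc ha.
Qed.

(** The inequality 1 + x <= e^x, at x = -1/(n+2) and, after inversion, at x = 1/(n+1), encloses the
    ratio between e^(-n/(n+1)) and e^(-n/(n+2)). *)
Lemma cvg_pf_weight_ratio :
  (fun n => pf_weight n / pf_weight n.+1) @ \oo --> expR (-1).
Proof.
apply: (@squeeze_cvgr _ _ _ _ (fun n => expR (harmonic n - 1))
   (fun n => expR (2 * harmonic n.+1 - 1))).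
- near=> n; rewrite pf_weight_ratio; apply/andP; split.
    rewrite (_ : harmonic n - 1 = n%:R * - n.+1%:R^-1); last first.
      by rewrite /harmonic /= -[X in X^-1 - _]natr1 -[X in _ * - X^-1]natr1;
        field; rewrite ?nat1r ?natr1 pnatr_eq0.
    rewrite expRM_natl lerXn2r ?nnegrE ?expR_ge0 ?divr_ge0 //.
    rewrite expRN -[leRHS]invf_div lef_pV2 ?posrE ?expR_gt0 ?divr_gt0 //.
    apply: le_trans (expR_ge1Dx _); rewrite le_eqVlt; apply/orP; left;
      apply/eqP.
    by rewrite -[n.+2%:R]natr1 mulrDl divff ?pnatr_eq0 // mul1r.
  rewrite (_ : 2 * harmonic n.+1 - 1 = n%:R * - n.+2%:R^-1); last first.
    rewrite /harmonic /=.
    have -> : n%:R = n.+2%:R - 2 :> R by rewrite -natrB // subn2.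
    have h : n.+2%:R != 0 :> R by rewrite pnatr_eq0.
    by rewrite mulrN mulrBl divff // opprB.
  rewrite expRM_natl lerXn2r ?nnegrE ?expR_ge0 ?divr_ge0 //.
  apply: le_trans (expR_ge1Dx _); rewrite le_eqVlt; apply/orP; left; apply/eqP.
  rewrite -[in LHS]natr1 [X in X / _](_ : _ = n.+2%:R - 1); last first.
    by rewrite -[n.+2%:R]natr1 addrK -natr1.
  by rewrite mulrBl divff ?pnatr_eq0 // mul1r.
- apply: (@cvg_comp _ _ _ (fun n => harmonic n - 1 : R) expR _ (nbhs (-1 : R)));
    last exact: continuous_expR.
  rewrite -[X in _ `=>` nbhs X]add0r.
  by apply: cvgB; [exact: cvg_harmonic|exact: cvg_cst].
- apply: (@cvg_comp _ _ _ (fun n => 2 * harmonic n.+1 - 1 : R) expR _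
    (nbhs (-1 : R))); last exact: continuous_expR.
  rewrite -[X in _ `=>` nbhs X]add0r; apply: cvgB; last exact: cvg_cst.
  rewrite -[X in _ `=>` nbhs X](mulr0 2); apply: cvgM; first exact: cvg_cst.
  have := @cvg_harmonic R; rewrite -(cvg_shiftn 1) => H.
  by under eq_fun do rewrite -addn1.
Unshelve. all: by end_near. Qed.
Lemma cvg_subn (u : nat -> R) (l : R) i :
  u @ \oo --> l -> (fun n => u (n - i)%N) @ \oo --> l.
Proof.
move=> ul; rewrite -(cvg_shiftn i).
by under [X in X @ _ --> _]eq_fun do rewrite addnK.
Qed.

(** The quotient telescopes into [i] consecutive quotients, each tending to e^(-1). *)
Lemma cvg_pf_weight_subn i :
  (fun n => pf_weight (n - i) / pf_weight n) @ \oo --> expR (-1) ^+ i.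
Proof.
elim: i => [|i IHi].
  under eq_fun do rewrite subn0 divff ?pf_weight_neq0 //.
  exact: cvg_cst.
have step : (fun n => pf_weight n.-1 / pf_weight n) @ \oo --> expR (-1).
  rewrite -(cvg_shiftn 1); have := cvg_pf_weight_ratio.
  by under [X in _ -> X @ _ --> _]eq_fun do rewrite addn1 /=.
rewrite exprS.
rewrite (_ : (fun n => _) = (fun n => pf_weight (n - i).-1 / pf_weight
  (n - i)) \*
    (fun n => pf_weight (n - i) / pf_weight n)); last first.
  by apply/funext => n /=; rewrite mulrA mulfVK ?pf_weight_neq0 // subnS.
exact: cvgM (cvg_subn (fun n => pf_weight n.-1 / pf_weight n) _ i step) IHi.
Qed.

Lemma cvg_pf_term k i : cvgn (pf_ratio R k) ->
  (fun n => exp_coeff 1 i * (pf_weight (n - i) / pf_weight n) *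
            pf_ratio R k (n - i)) @ \oo -->
  exp_coeff (expR (-1)) i * pf_mu R k.
Proof.
move=> cvk; apply: cvgM; last exact: cvg_subn.
rewrite (_ : exp_coeff (expR (-1)) i = exp_coeff 1 i * expR (-1) ^+ i);
  last first.
  by rewrite /exp_coeff /= expr1n mul1r mulrC.
by apply: cvgM; [exact: cvg_cst|exact: cvg_pf_weight_subn].
Qed.

Lemma cvg_sum_ord m (u : nat -> nat -> R) (l : nat -> R) :
  (forall i, (i < m)%N -> u i @ \oo --> l i) ->
  (fun n => \sum_(i < m) u i n) @ \oo --> \sum_(i < m) l i.
Proof.
elim: m => [|m IHm] ul.
  by under eq_fun do rewrite big_ord0; rewrite big_ord0; exact: cvg_cst.
under eq_fun do rewrite big_ord_recr /=; rewrite big_ord_recr /=.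
by apply: cvgD; [apply: IHm => i im; apply: ul; exact: ltnW|exact: ul].
Qed.

(** In [pf_ratioS] the term [i = 0] is [pf_ratio k.+1] with coefficient 1; solving for it expresses
    it by ratios already known to converge. *)
Lemma is_cvg_pf_ratio k : cvgn (pf_ratio R k).
Proof.
elim/ltn_ind: k => -[_|k IHk].
  have -> : pf_ratio R 0 = fun=> 1 by apply/funext => n; exact: pf_ratio0.
  exact: is_cvg_cst.
apply/cvg_ex; exists (pf_mu R k - \sum_(i < k.+1)
  exp_coeff (expR (-1)) i.+1 * pf_mu R (k.+1 - i.+1)).
have cvk : pf_ratio R k @ \oo --> pf_mu R k by exact: (IHk k (ltnSn k)).
apply: cvg_trans; last first.
  apply: (cvgB cvk).
  apply: (cvg_sum_ord k.+1 _ (fun i => exp_coeff (expR (-1)) i.+1 *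
                                       pf_mu R (k.+1 - i.+1))) => i _.
  by apply: cvg_pf_term; apply: IHk; rewrite subSS ltnS leq_subr.
apply: near_eq_cvg; near=> n.
have kn : (k < n)%N by near: n; exact: nbhs_infty_gt.
rewrite /= [X in X + _ = _](pf_ratioS k n kn). rewrite big_ord_recl !subn0.
rewrite divff ?pf_weight_neq0 // mulr1 {1}/exp_coeff /= expr0 fact0 divr1 mul1r.
exact: addrK.
Unshelve. all: by end_near. Qed.

Lemma pf_mu_conv k :
  pf_mu R k = \sum_(i < k.+2) exp_coeff (expR (-1)) i * pf_mu R (k.+1 - i).
Proof.
apply: cvg_lim => //; apply: cvg_trans; last first.
  apply: (cvg_sum_ord k.+2 _ (fun i => exp_coeff (expR (-1)) i *
                                       pf_mu R (k.+1 - i))) => i _.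
  exact: cvg_pf_term (is_cvg_pf_ratio (k.+1 - i)).
apply: near_eq_cvg; near=> n.
by rewrite (pf_ratioS k n) //; near: n; exact: nbhs_infty_gt.
Unshelve. all: by end_near. Qed.

Lemma pf_mu0 : pf_mu R 0 = 1.
Proof.
rewrite /pf_mu (_ : pf_ratio R 0 = fun=> 1) ?lim_cst //.
by apply/funext => n; exact: pf_ratio0.
Qed.

Lemma pf_mu_ge0 k : 0 <= pf_mu R k.
Proof.
apply: limr_ge; first exact: is_cvg_pf_ratio.
by near=> n; rewrite divr_ge0.
Unshelve. all: by end_near. Qed.

(** Dropping the bound on the letters gives [pf_ratio 0], which is constantly 1. The bounds 0 and 1
    later make the radius of convergence positive. *)
Lemma pf_mu_le1 k : pf_mu R k <= 1.
Proof.
apply: limr_le; first exact: is_cvg_pf_ratio.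
near=> n; rewrite -[leRHS](pf_ratio0 n) ler_wpM2r ?invr_ge0 // ler_nat.
apply: subset_leq_card; apply/fintype.subsetP => t; rewrite !inE subn0.
by move=> /andP[-> _] /=; apply/allP => i _; exact: ltn_ord.
Unshelve. all: by end_near. Qed.

End Limits.

(** * Recurrence, closed formula and formal inverse *)

Section Coefficients.
Variable R : realType.
Let q : R := expR (-1).

Lemma expR_opp_nat i : expR (- i%:R) = q ^+ i.
Proof. by rewrite -expRM_natl mulrN1. Qed.

(** This is [abel_coeff_sum] for the array e^(-i) mu_(k-i): its corner is mu_0 = 1, and the term
    [i = 0] of the sum is mu_k. *)
Lemma pf_mu_abel k : (1 <= k)%N ->
  pf_mu R k =
    1 - \sum_(1 <= i < k.+1)
          (k - i + 1)%N%:R * (k + 1)%N%:R ^+ (i - 1) / i`!%:R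
          * expR (- i%:R) * pf_mu R (k - i).
Proof.
move=> k1.
have := @abel_coeff_sum R k (fun k i => q ^+ i * pf_mu R (k - i)) _ k (leqnn k).
rewrite /= subn0 expr0 mul1r pf_mu0 => H; rewrite [X in X - _]H; last first.
  move=> j i /andP[ij _]; rewrite pf_mu_conv mulr_sumr.
  have -> : ((j - i).+2 = j.+2 - i)%N by lia.
  apply: eq_bigr => l _; rewrite subnDA -subSn // exprD /exp_coeff /= expr1n.
  by rewrite -/q; ring.
rewrite -(big_mkord xpredT (fun i => abel_coeff R k i * (q ^+ i * pf_mu R
  (k - i)))).
rewrite big_nat_recl // [abel_coeff _ _ 0%N]/abel_coeff /exp_coeff /=.
rewrite !expr0 fact0 divr1 subr0 !mul1r subn0 big_add1 /= -addrA.
rewrite -[LHS]addr0; congr (_ + _); apply/esym/eqP; rewrite subr_eq0; apply/eqP.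
apply: eq_big_nat => i /andP[_ ik].
by rewrite abel_coeffE // expR_opp_nat mulrA.
Qed.

(** The coefficient of x^k in the sum over m of x^m e^(-(m+1)qx), the geometric expansion of 1 /
    (e^(qx) - x). *)
Definition pf_mu_closed k : R :=
  \sum_(i < k.+1) exp_coeff (- (k.+1 - i)%N%:R * q) i.

Lemma pf_mu_closed_conv k :
  pf_mu_closed k = \sum_(i < k.+2) exp_coeff q i * pf_mu_closed (k.+1 - i).
Proof.
transitivity (\sum_(i < k.+2) \sum_(l < (k.+2 - i)%N)
    exp_coeff q i * exp_coeff (- (k.+2 - (i + l))%N%:R * q) l); last first.
  apply: eq_bigr => i _; rewrite /pf_mu_closed mulr_sumr.
  have ik : (i <= k.+1)%N by rewrite -ltnS ltn_ord.
  rewrite -subSn //.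
  by apply: eq_bigr => l _; rewrite subnDA.
rewrite (sum_triangle R k.+2
  (fun i l => exp_coeff q i * exp_coeff (- (k.+2 - (i + l))%N%:R * q) l)).
transitivity (\sum_(t < k.+2) exp_coeff (- (k.+1 - t)%N%:R * q) t).
  (* The additional term [t = k.+1] is a positive power of 0. *)
  rewrite [RHS]big_ord_recr /= subnn oppr0 mul0r.
  by rewrite {2}/exp_coeff /= expr0n /= mul0r addr0.
apply: eq_bigr => t _.
under [RHS]eq_bigr => i _ do rewrite subnKC -1?ltnS //.
rewrite exp_coeffD; congr exp_coeff.
have tk : (t <= k.+1)%N by rewrite -ltnS ltn_ord.
rewrite (subSn tk).
by rewrite -natr1; ring.
Qed.

(** Both sequences start at 1 and satisfy the same convolution, which determines entry [k.+1]
    because its coefficient there is 1. *)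
Lemma pf_mu_closedE k : pf_mu R k = pf_mu_closed k.
Proof.
elim/ltn_ind: k => -[_|k IHk].
  by rewrite pf_mu0 /pf_mu_closed big_ord1 /exp_coeff /= expr0 fact0 divr1.
have e0 x : exp_coeff x 0 = 1 :> R by rewrite /exp_coeff /= expr0 fact0 divr1.
have := pf_mu_conv R k; rewrite (IHk k) // pf_mu_closed_conv.
rewrite big_ord_recl [RHS]big_ord_recl !subn0 !e0 !mul1r.
rewrite [X in _ = _ + X -> _](_ : _ = \sum_(i < k.+1)
   exp_coeff q (lift ord0 i) * pf_mu_closed (k.+1 - lift ord0 i)).
  by move=> H; exact/esym/(addIr _ H).
by apply: eq_bigr => i _; rewrite IHk // lift0 subSS ltnS leq_subr.
Qed.

Lemma fps_mul_pf_mu k : fps_mul (pf_mu R) (@fps_exp_sub_X R) k = fps_one R k.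
Proof.
have XE j : fps_exp_sub_X R j = exp_coeff q j - (j == 1%N)%:R.
  by rewrite /fps_exp_sub_X /exp_coeff /= /q expRN.
rewrite /fps_mul /fps_one (reindex_inj rev_ord_inj) /=.
under eq_bigr => i _.
  rewrite subSS (_ : (k - (k - i) = i)%N) ?subKn -1?ltnS // XE mulrBr.
  over.
rewrite sumrB; case: k => [|k].
  by rewrite !big_ord1 pf_mu0 /exp_coeff /= expr0 fact0 divr1 mulr1 mulr0 subr0.
under eq_bigr => i _ do rewrite mulrC.
rewrite -pf_mu_conv 2!big_ord_recl big1 /=; last by move=> i _; rewrite mulr0.
by rewrite mulr0 mulr1 addr0 add0r subn1 subrr.
Qed.

End Coefficients.

(** * Cauchy products of absolutely convergent series *)

Section Product.
Variable R : realType.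
Implicit Types a b : nat -> R.

Lemma series_fps_mul a b n :
  series (fps_mul a b) n = \sum_(i < n) \sum_(j < (n - i)%N) a i * b j.
Proof.
by rewrite /series /= big_mkord (sum_triangle R n (fun i j => a i * b j)).
Qed.

(** The square [i, j < n] minus the triangle [i + j < n], kept as an explicit sum so that it can be
    bounded termwise. *)
Lemma series_mulB a b n :
  series a n * series b n - series (fps_mul a b) n =
  \sum_(i < n) \sum_(n - i <= j < n) a i * b j.
Proof.
rewrite series_fps_mul /series /= !big_mkord mulr_suml -sumrB.
apply: eq_bigr => i _; rewrite mulr_sumr.
rewrite -!(big_mkord xpredT (fun j => a i * b j)).
by rewrite (big_cat_nat (leq0n _) (leq_subr i n)) /= addrAC subrr add0r.
Qed.

Lemma series_fps_mul_le a b n :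
  (forall i, 0 <= a i) -> (forall i, 0 <= b i) ->
  series (fps_mul a b) n <= series a n * series b n.
Proof.
move=> a0 b0; rewrite -subr_ge0 series_mulB.
by do 2![apply: sumr_ge0 => ? _]; exact: mulr_ge0.
Qed.

(** The square of side [n] lies inside the triangle [i + j < n.*2]. *)
Lemma series_mul_le a b n :
  (forall i, 0 <= a i) -> (forall i, 0 <= b i) ->
  series a n * series b n <= series (fps_mul a b) n.*2.
Proof.
move=> a0 b0; rewrite series_fps_mul /series /= !big_mkord mulr_suml.
have nn : (n <= n.*2)%N by lia.
rewrite (big_ord_widen _ (fun i => a i * \sum_(j < n) b j) nn) big_mkcond /=.
apply: ler_sum => i _; case: ifP => lin; last first.
  by apply: sumr_ge0 => j _; exact: mulr_ge0.
have ni : (n <= n.*2 - i)%N by lia.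
rewrite mulr_sumr (big_ord_widen _ (fun j => a i * b j) ni) big_mkcond /=.
by apply: ler_sum => j _; case: ifP => // _; exact: mulr_ge0.
Qed.

Lemma cvg_fps_mul_ge0 a b :
  (forall i, 0 <= a i) -> (forall i, 0 <= b i) ->
  cvgn (series a) -> cvgn (series b) ->
  series (fps_mul a b) @ \oo --> limn (series a) * limn (series b).
Proof.
move=> a0 b0 ca cb.
have sa0 n : 0 <= series a n by apply: sumr_ge0.
have sb0 n : 0 <= series b n by apply: sumr_ge0.
have nda : nondecreasing_seq (series a).
  by apply/nondecreasing_seqP => n; rewrite seriesSr lerDl.
have ndb : nondecreasing_seq (series b).
  by apply/nondecreasing_seqP => n; rewrite seriesSr lerDl.
have ndc : nondecreasing_seq (series (fps_mul a b)).
  apply/nondecreasing_seqP => n; rewrite seriesSr lerDl.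
  by apply: sumr_ge0 => i _; exact: mulr_ge0.
have cab : (fun n => series a n * series b n) @ \oo -->
   limn (series a) * limn (series b) by exact: cvgM.
have ub n : series (fps_mul a b) n <= limn (series a) * limn (series b).
  apply: le_trans (series_fps_mul_le _ _ n a0 b0) _.
  by apply: ler_pM => //; exact: nondecreasing_cvgn_le.
have cc : cvgn (series (fps_mul a b)).
  apply: nondecreasing_is_cvgn => //.
  by exists (limn (series a) * limn (series b)) => _ [n _ <-].
suff <- : limn (series (fps_mul a b)) = limn (series a) * limn (series b) by [].
apply/eqP; rewrite eq_le; apply/andP; split.
  by apply: limr_le => //; near=> n.
rewrite -(cvg_lim _ cab) //; apply: limr_le; first by apply/cvg_ex; eexists;
  exact: cab.
near=> n; apply: le_trans (series_mul_le _ _ n a0 b0) _.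
exact: nondecreasing_cvgn_le.
Unshelve. all: by end_near. Qed.

(** The error [d] is dominated by the same error [d'] for absolute values, which tends to 0 by the
    nonnegative case. *)
Lemma cvg_fps_mul a b :
  cvgn (series (fun i => `|a i|)) -> cvgn (series (fun i => `|b i|)) ->
  series (fps_mul a b) @ \oo --> limn (series a) * limn (series b).
Proof.
set a' := fun i => `|a i|; set b' := fun i => `|b i|.
move=> ca' cb'; have ca : cvgn (series a) by exact: normed_cvg.
have cb : cvgn (series b) by exact: normed_cvg.
have c' := cvg_fps_mul_ge0 a' b' (fun=> normr_ge0 _) (fun=> normr_ge0 _)
  ca' cb'.
pose d n := series a n * series b n - series (fps_mul a b) n.
pose d' n := series a' n * series b' n - series (fps_mul a' b') n.
have d'0 : d' @ \oo --> (0 : R).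
  by rewrite -(subrr (limn (series a') * limn (series b'))); apply: cvgB c';
    exact: cvgM.
have d0 : d @ \oo --> (0 : R).
  apply: norm_cvg0; apply: (@squeeze_cvgr _ _ _ _ (fun=> 0) d') => //;
    last exact: cvg_cst.
  near=> n; rewrite normr_ge0 /= /d /d' !series_mulB.
  apply: le_trans (ler_norm_sum _ _ _) _; apply: ler_sum => i _.
  apply: le_trans (ler_norm_sum _ _ _) _; apply: ler_sum => j _.
  by rewrite normrM.
rewrite (_ : series (fps_mul a b) =
             fun n => series a n * series b n - d n); last first.
  by apply/funext => n; rewrite /d opprB addrC subrK.
by rewrite -[X in _ --> X]subr0; apply: cvgB d0; exact: cvgM.
Unshelve. all: by end_near. Qed.

End Product.

(** * Generating function *)

Section GeneratingFunction.
Variable R : realType.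

(** Since the coefficients lie between 0 and 1, a geometric series dominates at the point 1/2. *)
Lemma cv_radius_pf_mu_gt0 : (0 < cv_radius (pf_mu R))%E.
Proof.
apply: (@lt_le_trans _ _ `|2^-1 : R|%:E);
  first by rewrite lte_fin normr_gt0 invr_eq0 pnatr_eq0.
apply: ereal_sup_ubound; exists 2^-1 => //=.
have h0 n : 0 <= (2^-1 : R) ^+ n by rewrite exprn_ge0 // invr_ge0.
apply: (@series_le_cvg _ _ (geometric 1 2^-1)) => [n|n|n|] /=.
- by rewrite mulr_ge0 ?pf_mu_ge0.
- by rewrite mul1r.
- by rewrite ler_wpM2r ?pf_mu_le1.
- by apply: is_cvg_geometric_series;
    rewrite ger0_norm ?invr_ge0 // invf_lt1 // ltr1n.
Qed.

(** By [pf_mu_conv] the Cauchy product with the series of e^(x/e) has terms 1, x a_0, x a_1, and so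
    on, so the sum L satisfies L e^(x/e) = 1 + x L. *)
Lemma cvg_pseries_pf_mu (x : R) : (`|x|%:E < cv_radius (pf_mu R))%E ->
  expR (x / expR 1) - x != 0 /\
  pseries (pf_mu R) x @ \oo --> (expR (x / expR 1) - x)^-1.
Proof.
move=> /ereal_sup_gt[_ [y /= cvy <-]]; rewrite lte_fin => xy.
pose a : nat -> R := fun i => pf_mu R i * x ^+ i.
pose b : nat -> R := exp_coeff (x / expR 1).
have ca' : cvgn (series (fun i => `|a i|)).
  have := is_cvg_pseries_inside_norm (z := `|x|) cvy.
  rewrite normr_id => /(_ xy).
  rewrite (_ : (fun i => `|a i|) = fun i => `|pf_mu R i| * `|x| ^+ i) //.
  by apply/funext => i; rewrite /a normrM normrX.
have cb' : cvgn (series (fun i => `|b i|)).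
  rewrite /b; move: (x / _) => z.
  rewrite (_ : (fun i => _) = exp_coeff `|z|);
    first exact: is_cvg_series_exp_coeff.
  by apply/funext => i; rewrite /exp_coeff /= normrM normrX normfV normr_nat.
have ca : cvgn (series a) by exact: is_cvg_pseries_inside cvy xy.
have prod := cvg_fps_mul R a b ca' cb'; rewrite -/(expR (x / expR 1)) in prod.
have coefE n : fps_mul a b n.+1 = x * a n.
  rewrite /a pf_mu_conv mulr_suml mulr_sumr /fps_mul
    (reindex_inj rev_ord_inj) /=.
  apply: eq_bigr => i _.
  have ik : (i <= n.+1)%N by rewrite -ltnS ltn_ord.
  rewrite subSS subKn // /b /exp_coeff /= expr_div_n expRN -exprVn.
  rewrite [RHS](_ : _ = x ^+ n.+1 * ((expR 1)^-1 ^+ i / i`!%:R * pf_mu R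
    (n.+1 - i)));
    last by rewrite exprS; ring.
  have -> : x ^+ n.+1 = x ^+ (n.+1 - i) * x ^+ i by rewrite -exprD subnK.
  by ring.
have coef0 : fps_mul a b 0 = 1.
  by rewrite /fps_mul big_ord1 /a /b /exp_coeff /= pf_mu0 !expr0 fact0
    divr1 !mulr1.
have prodE n : series (fps_mul a b) n.+1 = 1 + x * series a n.
  rewrite /series /= big_nat_recl // coef0 mulr_sumr.
  by under eq_bigr do rewrite coefE.
have lim1 : (fun n => 1 + x * series a n) @ \oo --> 1 + x * limn (series a).
  by apply: cvgD; [exact: cvg_cst|apply: cvgM => //; exact: cvg_cst].
have eqn : limn (series a) * expR (x / expR 1) = 1 + x * limn (series a).
  rewrite -(cvg_lim _ lim1) //; apply/esym/cvg_lim => //.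
  move: prod; rewrite -(cvg_shiftn 1).
  by under [X in X @ _ --> _]eq_fun do rewrite addn1 prodE.
have {}eqn : limn (series a) * (expR (x / expR 1) - x) = 1.
  by rewrite mulrBr eqn; ring.
(* The product with the limit is 1, so neither factor can vanish. *)
have nz : expR (x / expR 1) - x != 0.
  by apply/eqP => z; move: eqn; rewrite z mulr0 => /esym/eqP; rewrite oner_eq0.
split=> //; suff <- : limn (series a) = (expR (x / expR 1) - x)^-1 by [].
by apply: (mulIf nz); rewrite eqn mulVf.
Qed.

End GeneratingFunction.

Theorem theorem4p1 (R : realType) :
  (forall k : nat, cvgn (pf_ratio R k)) /\
  pf_mu R 0 = 1 /\
  (forall k : nat, (1 <= k)%N ->
     pf_mu R k =
       1 - \sum_(1 <= i < k.+1)
             (k - i + 1)%N%:R * (k + 1)%N%:R ^+ (i - 1) / i`!%:R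
             * expR (- i%:R) * pf_mu R (k - i)) /\
  (forall k : nat,
     pf_mu R k =
       \sum_(0 <= i < k.+1)
          (-1) ^+ i * (k + 1 - i)%N%:R ^+ i / i`!%:R * expR (- i%:R)) /\
  (forall k : nat, fps_mul (pf_mu R) (@fps_exp_sub_X R) k = fps_one R k) /\
  (0 < cv_radius (pf_mu R))%E /\
  (forall x : R, (`|x|%:E < cv_radius (pf_mu R))%E ->
     expR (x / expR 1) - x != 0 /\
     pseries (pf_mu R) x @ \oo --> (expR (x / expR 1) - x)^-1).
Proof.
split; first exact: is_cvg_pf_ratio.
split; first exact: pf_mu0.
split; first exact: pf_mu_abel.
split.
  move=> k; rewrite pf_mu_closedE big_mkord; apply: eq_bigr => i _.
  rewrite /exp_coeff /= expR_opp_nat -mulN1r !exprMn addn1; ring.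
split; first exact: fps_mul_pf_mu.
split; first exact: cv_radius_pf_mu_gt0.
exact: cvg_pseries_pf_mu.
Qed.
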